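(* There exist an oracle $B \subseteq \{0,1\}^*$ and a set $A \subseteq \{0,1\}^*$ such that $A$ is $\leqslant^{\mathrm{P}}_{2-\mathrm{T}}$-complete for $\mathrm{EXP}^B$, but $A$ is not autoreducible relative to $B$; that is, there is no deterministic polynomial-time oracle Turing machine $M$ with access to both $B$ and a second oracle such that $M$ with oracles $B$ and $A$ decides $A$ and, for any input $x$ and any second oracle, $M$ on input $x$ does not query $x$ to the second oracle.
   Context: $\mathrm{EXP}^B$ is the class of sets decidable by deterministic oracle Turing machines with oracle $B$ running in time $2^{n^{O(1)}}$ (queries to $B$ may be exponentially long). We write $D \leqslant^{\mathrm{P}}_{2-\mathrm{T}} A$ if there is a deterministic polynomial-time oracle Turing machine $M$ such that $M^A$ decides $D$ and $M$ makes at most 2 (possibly adaptive) oracle queries on every input. A set $A$ is $\leqslant^{\mathrm{P}}_{2-\mathrm{T}}$-complete for a class $\mathcal{C}$ if $A \in \mathcal{C}$ and every set $D \in \mathcal{C}$ satisfies $D \leqslant^{\mathrm{P}}_{2-\mathrm{T}} A$. *)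

(* Defs.v *)
From mathcomp Require Import all_boot.

Set Implicit Arguments.
Unset Strict Implicit.
Unset Printing Implicit Defensive.

Definition word := seq bool.
Definition language := pred word.

(** * Deterministic multitape Turing machines with [m] oracles *)

(* [None] is the blank, [Some (inl b)] the bit [b], and [Some (inr g)] an
   auxiliary symbol. *)
Definition symbol (G : finType) : finType := option (bool + G).

Variant direction := Left | Stay | Right.

(* Every state is of exactly one kind.  A query state for the oracle [i] has its
   own pair of successor states, for the answers yes and no. *)
Variant instruction (m : nat) (Q T G : finType) :=
| Halt of bool
| Query of 'I_m & Q & Q
| Step of ({ffun T -> symbol G} -> Q * {ffun T -> symbol G * direction}).

Record oracle_machine (m : nat) := OracleMachine {
  state : finType;
  tape_index : finType;
  aux_symbol : finType;
  start : state;
  input_tape : tape_index;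
  query_tape : 'I_m -> tape_index;
  program : state -> instruction m state tape_index aux_symbol
}.

(* A tape is infinite to the right only: the list of its first cells, all later
   cells being blank, and the position of the head. *)
Definition tape (G : finType) : Type := seq (symbol G) * nat.

Definition read G (t : tape G) : symbol G := nth None t.1 t.2.

(* A left move from the cell 0 leaves the head in place. *)
Definition move (d : direction) (h : nat) : nat :=
  match d with Left => h.-1 | Stay => h | Right => h.+1 end.

Definition write_move G (t : tape G) (a : symbol G * direction) : tape G :=
  (set_nth None t.1 t.2 a.1, move a.2 t.2).

(* The word on a tape is the longest string of bits starting at the cell 0. *)
Fixpoint bits_of G (s : seq (symbol G)) : word :=
  if s is Some (inl b) :: s' then b :: bits_of s' else [::].

Section Runs.
Variables (m : nat) (M : oracle_machine m).

Definition config : Type :=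
  state M * (tape_index M -> tape (aux_symbol M)).

Definition init (x : word) : config :=
  (start M, fun j => (if j == input_tape M then [seq Some (inl b) | b <- x]
                      else [::], 0)).

Definition query_word (c : config) (i : 'I_m) : word :=
  bits_of (c.2 (query_tape M i)).1.

Definition step (O : m.-tuple language) (c : config) : config :=
  match program c.1 with
  | Halt _ => c
  | Query i qyes qno =>
      (if tnth O i (query_word c i) then qyes else qno, c.2)
  | Step delta =>
      let: (q, acts) := delta [ffun j => read (c.2 j)] in
      (q, fun j => write_move (c.2 j) (acts j))
  end.

Definition run (O : m.-tuple language) (x : word) (t : nat) : config :=
  iter t (step O) (init x).

Definition verdict (c : config) : option bool :=
  if program c.1 is Halt b then Some b else None.

Definition query_of (c : config) : option ('I_m * word) :=
  if program c.1 is Query i _ _ then Some (i, query_word c i) else None.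

Definition halts_within (O : m.-tuple language) (x : word) (t : nat) : Prop :=
  isSome (verdict (run O x t)).

Definition decides (O : m.-tuple language) (D : language) : Prop :=
  forall x, exists t, verdict (run O x t) = Some (D x).

Definition queries (O : m.-tuple language) (x : word) (t : nat) :
    seq ('I_m * word) :=
  pmap query_of [seq run O x s | s <- iota 0 t].

Definition polynomial_time : Prop :=
  exists c : nat, forall (O : m.-tuple language) (x : word),
    halts_within O x (size x ^ c + c).

Definition exponential_time (O : m.-tuple language) : Prop :=
  exists c : nat, forall x : word, halts_within O x (2 ^ (size x ^ c + c)).

End Runs.

(** * Complexity classes, reductions, autoreducibility *)

Definition EXP (B : language) (D : language) : Prop :=
  exists M : oracle_machine 1,
    exponential_time M [tuple B] /\ decides M [tuple B] D.

Definition reducible_2T (D A : language) : Prop :=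
  exists M : oracle_machine 1,
    [/\ polynomial_time M,
        decides M [tuple A] D
      & forall (X : language) (x : word) (t : nat),
          size (queries M [tuple X] x t) <= 2].

Definition complete_2T (C : language -> Prop) (A : language) : Prop :=
  C A /\ forall D, C D -> reducible_2T D A.

(* [ord_max : 'I_2] is the index of the second oracle. *)
Definition autoreducible_relative_to (B A : language) : Prop :=
  exists M : oracle_machine 2,
    [/\ polynomial_time M,
        decides M [tuple B; A] A
      & forall (X : language) (x : word) (t : nat),
          (ord_max, x) \notin queries M [tuple B; X] x t].

(* Main.v *)
Require Import Defs.
From mathcomp Require Import all_boot zify.

Set Implicit Arguments.
Unset Strict Implicit.
Unset Printing Implicit Defensive.

(* Let the stages be a sequence of lengths [N], each exponential in the previous
   one.  The bit [A(1^N)] is a selector for all code words up to the next stage: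
   a set [D] of [EXP^B] is reduced to [A] by querying the selector [b := A(1^N)]
   and then a code word that carries [b] and encodes "[x] is in [D]".  The value
   of [A] on a code word carrying [b] is computed in the world where the selector
   is [b], whatever it actually is.  So [A] restricted to the words up to the
   next stage, except [1^N] itself, does not depend on the selector, and the
   selector can be chosen against a machine that computes [A(1^N)] from [B] and
   the other values of [A].  The oracle [B] is [A] with every word padded to
   exponential length: this puts [A] in [EXP^B], makes the definition of [A]
   well founded (a computation of [2^m] steps sees [A] on the words of length at
   most [m] only), and hides [A(1^N)] from a polynomial-time computation on
   [1^N]. *)

(** * Runs of oracle machines *)

Lemma size_bits_of (G : finType) (s : seq (symbol G)) : size (bits_of s) <= size s.
Proof. by elim: s => [|[[b|g]|] s IHs] /=. Qed.

Section RunTheory.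
Variables (m : nat) (M : oracle_machine m).
Implicit Types (O : m.-tuple language) (x : word) (t : nat).

Lemma verdict_stable O x s t :
  s <= t -> isSome (verdict (run M O x s)) ->
  verdict (run M O x t) = verdict (run M O x s).
Proof.
move=> le_st halted; rewrite -(subnK le_st).
elim: (t - s) => [//|d IHd]; rewrite addSn /run iterS -/(run M O x (d + s)).
move: IHd halted; move: (run M O x (d + s)) => c; rewrite /verdict /step.
by case E: (program c.1) => [b | i q1 q2 | f] <- //; rewrite E.
Qed.

Lemma queries_rcons O x t :
  queries M O x t.+1 =
  queries M O x t ++ seq_of_opt (query_of (run M O x t)).
Proof.
rewrite /queries -[t.+1]addn1 iotaD add0n map_cat pmap_cat /=.
by case: query_of.
Qed.

(** An oracle enters a run only through the answers given, and the part of the run already shown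
    equal fixes the next query. *)
Lemma run_agree O O' x t :
  (forall q, q \in queries M O x t -> tnth O q.1 q.2 = tnth O' q.1 q.2) ->
  run M O x t = run M O' x t.
Proof.
elim: t => [//|t IHt] agree; rewrite /run !iterS -!/(run _ _ _ t).
rewrite -IHt => [|q q_in]; last by apply: agree; rewrite queries_rcons mem_cat q_in.
have := agree; rewrite queries_rcons /step /query_of.
case: (program _) => // i q1 q2 /(_ (i, query_word (run M O x t) i)) /= -> //.
by rewrite mem_cat mem_seq1 eqxx orbT.
Qed.

Lemma tape_size O x t j (c := run M O x t) :
  size (c.2 j).1 <= size x + t /\ (c.2 j).2 <= t.
Proof.
rewrite {}/c; elim: t => [|t IHt].
  by rewrite /run /init /=; case: eqP; rewrite ?size_map ?addn0.
rewrite /run iterS -/(run M O x t) /step.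
case: IHt => IHs IHh; case: (program _) => [b | i q1 q2 | f] /=;
  rewrite ?addnS; try by split; apply: leqW.
case: (f _) => q acts /=; rewrite size_set_nth /move geq_max.
split; last by case: (acts j).2; rewrite // leqW // (leq_trans (leq_pred _)).
by rewrite ltnS (leq_trans IHh) ?leq_addl // leqW.
Qed.

Lemma query_size O x t q : q \in queries M O x t -> size q.2 <= size x + t.
Proof.
elim: t => [//|t IHt]; rewrite queries_rcons mem_cat => /orP[/IHt|]; first lia.
rewrite /query_of; case: (program _) => // i q1 q2; rewrite mem_seq1 => /eqP-> /=.
rewrite /query_word.
case: (tape_size O x t (query_tape M i)) => le_size _; rewrite addnS leqW //.
exact: leq_trans (size_bits_of _) le_size.
Qed.

End RunTheory.

(** * Enumeration of oracle machines *)

Lemma map_set_nth (T1 T2 : Type) (f : T1 -> T2) (x0 : T1) s n y :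
  map f (set_nth x0 s n y) = set_nth (f x0) (map f s) n (f y).
Proof.
elim: s n => [|x s IHs] [|n] //=; last by rewrite IHs.
by congr (_ :: _); elim: n => //= n ->.
Qed.

Section Enumeration.
Variable m : nat.

Section Code.
Variables a b g : nat.

(* [direction] has no [finType] structure: it is coded by [option bool]. *)
Definition action_code := {ffun 'I_b -> symbol 'I_g * option bool}.

Definition instruction_code : finType :=
  (bool + 'I_m * 'I_a * 'I_a +
   {ffun {ffun 'I_b -> symbol 'I_g} -> 'I_a * action_code})%type.

Definition code : finType :=
  ('I_a * 'I_b * {ffun 'I_m -> 'I_b} * {ffun 'I_a -> instruction_code})%type.

Definition decode_direction (o : option bool) : direction :=
  if o is Some l then if l then Left else Right else Stay.

Definition encode_direction (d : direction) : option bool :=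
  match d with Left => Some true | Stay => None | Right => Some false end.

Definition decode_instruction (c : instruction_code) :
    instruction m 'I_a 'I_b 'I_g :=
  match c with
  | inl (inl v) => Halt _ _ _ _ v
  | inl (inr (i, q1, q2)) => Query _ _ i q1 q2
  | inr f => Step _ (fun v => let: (q, acts) := f v in
      (q, [ffun j => ((acts j).1, decode_direction (acts j).2)]))
  end.

Definition decode (c : code) : oracle_machine m :=
  let: (q0, j0, qt, p) := c in
  @OracleMachine m 'I_a 'I_b 'I_g q0 j0 qt (fun q => decode_instruction (p q)).

End Code.

(** A machine carries arbitrary finite types of states, tapes and symbols. With ordinals in their
    place only countably many programs remain, and [pickle] numbers them. *)
Definition machine_code := {d : nat * nat * nat & code d.1.1 d.1.2 d.2}.

Definition rejecting_machine : oracle_machine m :=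
  @OracleMachine m unit unit unit tt tt (fun=> tt) (fun=> Halt _ _ _ _ false).

Definition machine_of (i : nat) : oracle_machine m :=
  if @unpickle machine_code i is Some c then decode (tagged c)
  else rejecting_machine.

Section Encode.
Variable M : oracle_machine m.
Let a := #|state M|.
Let b := #|tape_index M|.
Let g := #|aux_symbol M|.

Definition encode_symbol (s : symbol (aux_symbol M)) : symbol 'I_g :=
  match s with
  | Some (inr z) => Some (inr (enum_rank z))
  | Some (inl v) => Some (inl v)
  | None => None
  end.

Definition decode_symbol (s : symbol 'I_g) : symbol (aux_symbol M) :=
  match s with
  | Some (inr z) => Some (inr (enum_val z))
  | Some (inl v) => Some (inl v)
  | None => None
  end.

Lemma encode_symbolK : cancel encode_symbol decode_symbol.
Proof. by case=> [[v|z]|] //=; rewrite enum_rankK. Qed.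

Definition encode_instruction (c : instruction m (state M) (tape_index M) (aux_symbol M)) :
    instruction_code a b g :=
  match c with
  | Halt v => inl (inl v)
  | Query i q1 q2 => inl (inr (i, enum_rank q1, enum_rank q2))
  | Step f => inr [ffun v : {ffun 'I_b -> symbol 'I_g} =>
      let: (q, acts) := f [ffun j => decode_symbol (v (enum_rank j))] in
      (enum_rank q,
       [ffun j => (encode_symbol (acts (enum_val j)).1,
                   encode_direction (acts (enum_val j)).2)])]
  end.

Definition encode : code a b g :=
  (enum_rank (start M), enum_rank (input_tape M),
   [ffun i => enum_rank (query_tape M i)],
   [ffun q => encode_instruction (program (enum_val q))]).

Definition encode_tape (t : tape (aux_symbol M)) : tape 'I_g :=
  (map encode_symbol t.1, t.2).

(** Tapes are compared index by index, which avoids extensionality for functions. *)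
Definition same_config (c : config M) (c' : config (decode encode)) : Prop :=
  c'.1 = enum_rank c.1 /\ forall j, c'.2 (enum_rank j) = encode_tape (c.2 j).

Lemma bits_of_encode s : bits_of (map encode_symbol s) = bits_of s.
Proof. by elim: s => [//|[[v|z]|] s IHs] //=; rewrite IHs. Qed.

Lemma read_encode t : read (encode_tape t) = encode_symbol (read t).
Proof.
rewrite /read /=; have [lt|ge] := ltnP t.2 (size t.1); first exact: nth_map.
by rewrite !nth_default ?size_map.
Qed.

Lemma write_move_encode t s d :
  write_move (encode_tape t) (encode_symbol s, d) = encode_tape (write_move t (s, d)).
Proof. by rewrite /write_move /encode_tape /= map_set_nth. Qed.

Lemma query_word_encode c c' i :
  same_config c c' -> query_word c' i = query_word c i.
Proof.
case=> _ tapes; rewrite /query_word /= ffunE.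
by rewrite (tapes (query_tape M i)) bits_of_encode.
Qed.

Lemma step_encode O c c' :
  same_config c c' -> same_config (step O c) (step O c').
Proof.
move=> sc; have [st tapes] := sc; rewrite /step /= st ffunE enum_rankK.
case: (program c.1) => [v | i q1 q2 | f] //=.
  by split=> //=; rewrite (query_word_encode i sc); case: ifP.
rewrite ffunE.
have -> : [ffun j => decode_symbol ([ffun j0 => read (c'.2 j0)] (enum_rank j))] =
          [ffun j => read (c.2 j)].
  by apply/ffunP => j; rewrite !ffunE tapes read_encode encode_symbolK.
case: (f _) => q acts; split=> //= j.
rewrite !ffunE /= enum_rankK tapes.
have -> : decode_direction (encode_direction (acts j).2) = (acts j).2.
  by case: (acts j).2.
by rewrite write_move_encode -surjective_pairing.
Qed.

Lemma verdict_encode O x t :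
  verdict (run (decode encode) O x t) = verdict (run M O x t).
Proof.
suff [st _] : same_config (run M O x t) (run (decode encode) O x t).
  rewrite /verdict [in LHS]/= st ffunE enum_rankK.
  by case: (program _).
elim: t => [|t IHt]; last by rewrite /run !iterS; apply: step_encode.
split=> //= j; rewrite (inj_eq enum_rank_inj) /encode_tape /=.
by case: ifP => //; rewrite -map_comp.
Qed.

End Encode.

Lemma machine_ofP (M : oracle_machine m) :
  exists i, forall O x t, verdict (run (machine_of i) O x t) = verdict (run M O x t).
Proof.
pose c : machine_code :=
  @Tagged _ (#|state M|, #|tape_index M|, #|aux_symbol M|)
    (fun d => code d.1.1 d.1.2 d.2) (encode M).
exists (pickle c) => O x t; rewrite /machine_of pickleK; exact: verdict_encode.
Qed.

End Enumeration.

(** * Structured composition of machine fragments *)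

Section Fragments.
Variable n : nat.
Notation T := 'I_n.+2.
Notation sym := (symbol void).
Notation view := {ffun T -> sym}.
Notation tapes := (T -> tape void).

Implicit Types (j : T) (test : pred sym).

(** A query-free piece of program with a single exit, the missing successor state; the action of the
    leaving step is still performed. *)
Record fragment := Fragment {
  fstate : finType;
  fstart : fstate;
  fdelta : fstate -> view -> option fstate * {ffun T -> sym * direction}
}.

Definition idle (v : view) : {ffun T -> sym * direction} := [ffun j => (v j, Stay)].

Definition atom (j : T) (f : sym -> sym * direction) : fragment :=
  @Fragment unit tt
    (fun _ v => (None, [ffun k => if k == j then f (v k) else (v k, Stay)])).

Definition fseq (F G : fragment) : fragment :=
  @Fragment (fstate F + fstate G)%type (inl (fstart F)) (fun q v =>
    match q with
    | inl q => let: (o, a) := fdelta q v in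
        (Some (if o is Some q' then inl q' else inr (fstart G)), a)
    | inr q => let: (o, a) := fdelta q v in (omap inr o, a)
    end).

Definition fif (j : T) (test : pred sym) (F G : fragment) : fragment :=
  @Fragment (option (fstate F + fstate G)) None (fun q v =>
    match q with
    | None => (Some (Some (if test (v j) then inl (fstart F) else inr (fstart G))), idle v)
    | Some (inl q) => let: (o, a) := fdelta q v in (omap (Some \o inl) o, a)
    | Some (inr q) => let: (o, a) := fdelta q v in (omap (Some \o inr) o, a)
    end).

Definition fwhile (j : T) (test : pred sym) (F : fragment) : fragment :=
  @Fragment (option (fstate F)) None (fun q v =>
    match q with
    | None => (if test (v j) then Some (Some (fstart F)) else None, idle v)
    | Some q => let: (o, a) := fdelta q v in (Some o, a)
    end).

Definition view_of (s : tapes) : view := [ffun j => read (s j)].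

Definition act (s : tapes) (a : {ffun T -> sym * direction}) : tapes :=
  fun j => write_move (s j) (a j).

Inductive exits (F : fragment) : fstate F -> tapes -> nat -> tapes -> Prop :=
| exits_now q s a : fdelta q (view_of s) = (None, a) -> exits q s 1 (act s a)
| exits_later q s a q' t s' : fdelta q (view_of s) = (Some q', a) ->
    exits q' (act s a) t s' -> exits q s t.+1 s'.

Lemma exits_fseq (F G : fragment) q s t s1 t' s2 :
  @exits F q s t s1 -> @exits G (fstart G) s1 t' s2 ->
  @exits (fseq F G) (inl q) s (t + t') s2.
Proof.
move=> exF exG.
have exG' : @exits (fseq F G) (inr (fstart G)) s1 t' s2.
  elim: exG => {exF} [q0 s0 a eq_d|q0 s0 a q' t0 s' eq_d _ IH].
    by apply: exits_now; rewrite /= eq_d.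
  by apply: exits_later IH; rewrite /= eq_d.
elim: exF exG' => [q0 s0 a eq_d|q0 s0 a q' t0 s' eq_d _ IH] exG'.
  by apply: exits_later exG'; rewrite /= eq_d.
by apply: exits_later (IH exG'); rewrite /= eq_d.
Qed.

Lemma exits_fif j test (F G : fragment) s (b := test (read (s j))) t s' :
  (if b then @exits F (fstart F) (act s (idle (view_of s))) t s'
        else @exits G (fstart G) (act s (idle (view_of s))) t s') ->
  @exits (fif j test F G) None s t.+1 s'.
Proof.
move=> ex; apply: exits_later => /=; first by rewrite ffunE.
rewrite -/b; case: b ex => ex.
  elim: ex => [q0 s0 a eq_d|q0 s0 a q' t0 s1 eq_d _ IH].
    by apply: exits_now; rewrite /= eq_d.
  by apply: exits_later IH; rewrite /= eq_d.
elim: ex => [q0 s0 a eq_d|q0 s0 a q' t0 s1 eq_d _ IH].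
  by apply: exits_now; rewrite /= eq_d.
by apply: exits_later IH; rewrite /= eq_d.
Qed.

Lemma exits_fwhile_stop j test (F : fragment) s :
  ~~ test (read (s j)) ->
  @exits (fwhile j test F) None s 1 (act s (idle (view_of s))).
Proof. by move=> /negbTE stop; apply: exits_now; rewrite /= ffunE stop. Qed.

Lemma exits_fwhile_loop j test (F : fragment) s t s1 t' s2 :
  test (read (s j)) ->
  @exits F (fstart F) (act s (idle (view_of s))) t s1 ->
  @exits (fwhile j test F) None s1 t' s2 ->
  @exits (fwhile j test F) None s (t + t').+1 s2.
Proof.
move=> go exF exW; apply: (@exits_later (fwhile j test F) _ _ _ (Some (fstart F))).
  by rewrite /= ffunE go.
elim: exF exW => [q0 s0 a eq_d|q0 s0 a q' t0 s3 eq_d _ IH] exW.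
  by apply: exits_later exW; rewrite /= eq_d.
by apply: exits_later (IH exW); rewrite /= eq_d.
Qed.

(** * Words on tapes, and the primitive operations on them *)

Definition bit (b : bool) : sym := Some (inl b).

(* The tape 0 is the input, of which only the unread part counts; on the tape 1
   a word is written from the cell 0 on; any other tape is a stack with its top
   under the head, above a blank cell 0 that marks the bottom.  In all three
   cases the head of the list [l] is the symbol that is accessed first. *)
Definition holds (j : nat) (t : tape void) (l : word) : Prop :=
  if j == 0 then forall i, nth None t.1 (t.2 + i) = nth None (map bit l) i
  else t.2 = size l /\
       nth None t.1 =1 nth None (nseq (j != 1) None ++ map bit (rev l)).

Definition store := seq word.

Definition stored (st : store) (s : tapes) : Prop :=
  forall j : T, holds j (s j) (nth [::] st j).

Definition pop (j : T) : fragment :=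
  atom j (fun a => if j == 0 :> nat then (a, Right) else (None, Left)).

(** On a stack the head is on the top symbol and moves before writing; on the tape 1 it is already
    on the first free cell. *)
Definition push (j : T) (b : bool) : fragment :=
  if j == 1 :> nat then atom j (fun=> (bit b, Right))
  else fseq (atom j (fun a => (a, Right))) (atom j (fun=> (bit b, Stay))).

Lemma holds_read (j : nat) t l : j != 1 -> holds j t l -> read t = omap inl (ohead l).
Proof.
rewrite /holds /read => /negbTE j1; case: (eqVneq j 0) => [_ /(_ 0)|_ [-> ->]].
  by rewrite addn0 => ->; case: l.
rewrite j1; case: l => [//|b l] /=.
by rewrite rev_cons map_rcons nth_rcons size_map size_rev ltnn eqxx.
Qed.

(** Writing back the symbol read may still append blanks to the list of cells, so contents are
    compared through [nth]. *)
Lemma write_read (t : tape void) d i :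
  nth None (write_move t (read t, d)).1 i = nth None t.1 i.
Proof. by rewrite /write_move nth_set_nth /=; case: eqP => [->|]. Qed.

Lemma holds_idle (j : nat) t l : holds j t l -> holds j (write_move t (read t, Stay)) l.
Proof.
rewrite /holds; case: ifP => _ => [h i|[sz h]].
  by rewrite write_read.
by split=> // i; rewrite write_read.
Qed.

Lemma holds_pop (j : nat) t b l : j != 1 -> holds j t (b :: l) ->
  holds j (write_move t (if j == 0 then (read t, Right) else (None, Left))) l.
Proof.
rewrite /holds; case: (eqVneq j 0) => [_ _ h i | j0 j1 [sz h]].
  by rewrite write_read /= addSnnS h.
split; first by rewrite /= sz.
move=> i; rewrite /= nth_set_nth /= sz j1 h j1 /=.
case: eqP => [-> | neq] /=; first by rewrite nth_default // size_map size_rev.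
case: i neq => //= i neq; rewrite rev_cons map_rcons nth_rcons size_map size_rev.
case: ltngtP => // [gt | eq_i]; last by case: neq; rewrite eq_i.
by rewrite nth_default // size_map size_rev ltnW.
Qed.

Lemma holds_push1 t b l : holds 1 t l -> holds 1 (write_move t (bit b, Right)) (b :: l).
Proof.
rewrite /holds /= => -[sz h]; split=> [|i]; first by rewrite /= sz.
rewrite /= nth_set_nth /= sz h rev_cons map_rcons nth_rcons size_map size_rev.
case: (ltngtP i (size l)) => // gt.
by rewrite nth_default // size_map size_rev ltnW.
Qed.

Lemma holds_push (j : nat) t b l : 1 < j -> holds j t l ->
  holds j (write_move (write_move t (read t, Right)) (bit b, Stay)) (b :: l).
Proof.
rewrite /holds; case: j => [|[|j]] //= _ [sz h]; split=> [|i]; first by rewrite sz.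
have := write_read t Right i.
rewrite nth_set_nth /= sz => ->; rewrite h; case: i => [//|i] /=.
rewrite rev_cons map_rcons nth_rcons size_map size_rev eqSS.
case: (ltngtP i (size l)) => // gt.
by rewrite nth_default // size_map size_rev ltnW.
Qed.

Lemma stored_idle st s : stored st s -> stored st (act s (idle (view_of s))).
Proof. by move=> h j; rewrite /act !ffunE; apply: holds_idle. Qed.

Lemma stored_atom st s j f l :
  stored st s -> holds j (write_move (s j) (f (read (s j)))) l ->
  stored (set_nth [::] st j l)
    (act s [ffun k => if k == j then f (view_of s k) else (view_of s k, Stay)]).
Proof.
move=> h hj k; rewrite /act !ffunE nth_set_nth /= (inj_eq val_inj).
by case: eqP => [-> // | _]; apply: holds_idle.
Qed.

(** * Timed correctness of fragments *)

Definition computes (F : fragment) (st : store) (t : nat) (st' : store) : Prop :=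
  forall s, stored st s ->
    exists k s', [/\ k <= t, exits (fstart F) s k s' & stored st' s'].

Lemma computes_le F st t t' st' :
  t <= t' -> computes F st t st' -> computes F st t' st'.
Proof.
move=> le h s /h[k [s' [le_k ex st_s]]]; exists k, s'; split=> //.
exact: leq_trans le.
Qed.

Lemma computes_pop (j : T) st b l :
  j != 1 :> nat -> nth [::] st j = b :: l ->
  computes (pop j) st 1 (set_nth [::] st j l).
Proof.
move=> j1 nth_j s st_s.
exists 1; eexists; split; [by [] | by apply: exits_now | ].
apply: (stored_atom (f := fun a => if j == 0 :> nat then (a, Right) else (None, Left))) => //.
by apply: (@holds_pop _ _ b) => //; rewrite -nth_j.
Qed.

Lemma computes_push (j : T) b st :
  j != 0 :> nat -> computes (push j b) st 2 (set_nth [::] st j (b :: nth [::] st j)).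
Proof.
move=> j0 s st_s; rewrite /push; case: eqP => j1.
  exists 1; eexists; split; [by [] | by apply: exits_now | ].
  apply: (stored_atom (f := fun=> (bit b, Right))) => //.
  by have := st_s j; rewrite j1; apply: holds_push1.
exists 2; eexists; split; [by [] | | ].
  by apply: (@exits_fseq _ _ _ _ 1 _ 1); apply: exits_now.
move=> k; rewrite /act !ffunE nth_set_nth /= (inj_eq val_inj).
case: eqP => [-> | _]; last by do 2 apply: holds_idle.
by apply: holds_push (st_s j); lia.
Qed.

Lemma computes_seq F G st t st1 t' st2 :
  computes F st t st1 -> computes G st1 t' st2 ->
  computes (fseq F G) st (t + t') st2.
Proof.
move=> hF hG s /hF[k [s1 [le_k exF /hG[k' [s2 [le_k' exG st_s2]]]]]].
exists (k + k'), s2; split=> //; first exact: leq_add.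
exact: exits_fseq exF exG.
Qed.

Lemma computes_if (j : T) test F G st t st' :
  j != 1 :> nat ->
  computes (if test (omap inl (ohead (nth [::] st j))) then F else G) st t st' ->
  computes (fif j test F G) st t.+1 st'.
Proof.
move=> j1 h s st_s; have := h _ (stored_idle st_s).
rewrite -(holds_read j1 (st_s j)) => -[k [s' [le_k ex st_s']]].
exists k.+1, s'; split=> //; apply: exits_fif.
by case: (test _) ex.
Qed.

Lemma computes_while_stop (j : T) test F st :
  j != 1 :> nat -> ~~ test (omap inl (ohead (nth [::] st j))) ->
  computes (fwhile j test F) st 1 st.
Proof.
move=> j1 stop s st_s; exists 1, (act s (idle (view_of s))); split=> //.
  by apply: exits_fwhile_stop; rewrite (holds_read j1 (st_s j)).
exact: stored_idle.
Qed.

Lemma computes_while_loop (j : T) test F st t st1 t' st2 :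
  j != 1 :> nat -> test (omap inl (ohead (nth [::] st j))) ->
  computes F st t st1 -> computes (fwhile j test F) st1 t' st2 ->
  computes (fwhile j test F) st (t + t').+1 st2.
Proof.
move=> j1 go hF hW s st_s.
have [k [s1 [le_k exF /hW[k' [s2 [le_k' exW st_s2]]]]]] := hF _ (stored_idle st_s).
exists (k + k').+1, s2; split=> //; first by rewrite ltnS leq_add.
by apply: exits_fwhile_loop exF exW; rewrite (holds_read j1 (st_s j)).
Qed.

Definition foreach (j : T) (body : bool -> fragment) : fragment :=
  fwhile j isSome
    (fif j (pred1 (bit true)) (fseq (pop j) (body true)) (fseq (pop j) (body false))).

(** Here [l1] is the part already consumed and [l2] the rest. A round costs 3 besides the body: the
    loop test, the bit test and [pop]; the final 1 is the failing loop test. A relational invariant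
    serves [select], whose store has no explicit formula in [l1] and [l2]. *)
Lemma computes_foreach_inv (j : T) body (inv : word -> word -> store -> Prop) t l st :
  j != 1 :> nat -> (forall l1 l2 st, inv l1 l2 st -> nth [::] st j = l2) ->
  (forall l1 b l2 st, l = l1 ++ b :: l2 -> inv l1 (b :: l2) st ->
     exists2 st', computes (body b) (set_nth [::] st j l2) t st' & inv (rcons l1 b) l2 st') ->
  inv [::] l st ->
  exists2 st', computes (foreach j body) st (size l * (t + 3) + 1) st' & inv l [::] st'.
Proof.
move=> j1 nth_j hbody.
suff loop l1 l2 st0 : l = l1 ++ l2 -> inv l1 l2 st0 ->
    exists2 st', computes (foreach j body) st0 (size l2 * (t + 3) + 1) st' & inv l [::] st'.
  exact: loop.
elim: l2 l1 st0 => [|b l2 IHl] l1 st0 def_l inv0.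
  rewrite cats0 in def_l; rewrite def_l; exists st0 => //.
  by apply: computes_while_stop; rewrite ?(nth_j _ _ _ inv0).
have [st1 comp1 inv1] := hbody _ _ _ _ def_l inv0.
rewrite -cat_rcons in def_l; have [st2 comp2 inv2] := IHl _ _ def_l inv1.
exists st2 => //.
apply: computes_le (computes_while_loop (t := t.+2) j1 _ _ comp2).
- by rewrite /= !mulnDr !mulSn; lia.
- by rewrite (nth_j _ _ _ inv0).
apply: computes_if => //; rewrite (nth_j _ _ _ inv0) /=.
have hpop := computes_pop j1 (nth_j _ _ _ inv0).
by case: b comp1 hpop {def_l inv0 inv1} => comp1 hpop; apply: (computes_seq hpop comp1).
Qed.

Lemma computes_foreach (j : T) body (st : word -> word -> store) t l :
  j != 1 :> nat -> (forall l1 l2, nth [::] (st l1 l2) j = l2) ->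
  (forall l1 b l2, l = l1 ++ b :: l2 ->
     computes (body b) (set_nth [::] (st l1 (b :: l2)) j l2) t (st (rcons l1 b) l2)) ->
  computes (foreach j body) (st [::] l) (size l * (t + 3) + 1) (st l [::]).
Proof.
move=> j1 nth_j hbody.
have [|l1 b l2 _ def_l ->||st' comp <-] := @computes_foreach_inv j body
  (fun l1 l2 st' => st' = st l1 l2) t l (st [::] l) j1.
- by move=> l1 l2 _ ->.
- by exists (st (rcons l1 b) l2) => //; apply: hbody.
- by [].
- exact: comp.
Qed.

Lemma computes_move (j k : T) st :
  size st = n.+2 -> j != 1 :> nat -> k != 0 :> nat -> j != k ->
  computes (foreach j (push k)) st (size (nth [::] st j) * 5 + 1)
    (set_nth [::] (set_nth [::] st j [::]) k (catrev (nth [::] st j) (nth [::] st k))).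
Proof.
move=> sz j1 k0 jk; have jkE : (j == k :> nat) = false by rewrite (inj_eq val_inj) (negbTE jk).
have ltj := ltn_ord j; have ltk := ltn_ord k.
pose st_ l1 l2 := set_nth [::] (set_nth [::] st j l2) k (catrev l1 (nth [::] st k)).
have {1}-> : st = st_ [::] (nth [::] st j).
  apply: (@eq_from_nth _ [::]) => [|i _]; first by rewrite !size_set_nth sz; lia.
  by rewrite !nth_set_nth /=; case: eqP => [-> // | _]; rewrite nth_set_nth /=; case: eqP => [->|].
apply: (@computes_foreach j _ st_ 2) => // [l1 l2 | l1 b l2 _].
  by rewrite /st_ nth_set_nth /= jkE nth_set_nth /= eqxx.
have -> : st_ (rcons l1 b) l2 =
    set_nth [::] (set_nth [::] (st_ l1 (b :: l2)) j l2) k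
      (b :: nth [::] (set_nth [::] (st_ l1 (b :: l2)) j l2) k).
  apply: (@eq_from_nth _ [::]) => [|i _]; first by rewrite !size_set_nth sz; lia.
  have kjE : (k == j :> nat) = false by rewrite eq_sym.
  rewrite -cats1 /st_ catrev_catl !nth_set_nth /= kjE !nth_set_nth /= eqxx.
  case: (eqVneq i k) => //= ik; do 3! rewrite ?nth_set_nth /=.
  by case: (eqVneq i j) => // ij; rewrite (negbTE ik).
exact: computes_push.
Qed.

End Fragments.

(** * Machines with two queries *)

Lemma bits_of_holds (t : tape void) l : holds 1 t l -> bits_of t.1 = rev l.
Proof.
case=> _; move: t.1 (rev l) => {t l} s w /=.
elim: w s => [|b w IHw] [|a s] //= nth_s; try by have := nth_s 0.
  by have /= -> := nth_s 0.
by have /= -> := nth_s 0; congr (_ :: _); apply: IHw => i; apply: (nth_s i.+1).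
Qed.

Section TwoQuery.
Variables (n : nat) (F : fragment n) (G : bool -> fragment n).

(** First [F] runs; [inr None] is the first query, whose answer [b] selects [G b]; [inr (Some None)]
    is the second query, whose answer is the verdict. *)
Definition two_query_state : finType :=
  (fstate F + {b : bool & fstate (G b)} + option (option bool))%type.

Definition two_query_program (q : two_query_state) :
    instruction 1 two_query_state 'I_n.+2 void :=
  match q with
  | inl (inl q) => Step _ (fun v => let: (o, a) := fdelta q v in
      (if o is Some q' then inl (inl q') else inr None, a))
  | inl (inr u) => Step _ (fun v => let: (o, a) := fdelta (tagged u) v in
      (if o is Some q' then inl (inr (Tagged (fun b => fstate (G b)) q'))
       else inr (Some None), a))
  | inr None => Query _ _ ord0
      (inl (inr (Tagged (fun b => fstate (G b)) (fstart (G true)))))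
      (inl (inr (Tagged (fun b => fstate (G b)) (fstart (G false)))))
  | inr (Some None) => Query _ _ ord0 (inr (Some (Some true))) (inr (Some (Some false)))
  | inr (Some (Some v)) => Halt _ _ _ _ v
  end.

Definition two_query : oracle_machine 1 :=
  @OracleMachine 1 two_query_state 'I_n.+2 void (inl (inl (fstart F))) ord0
    (fun=> @Ordinal n.+2 1 isT) two_query_program.

Definition at_state (q : two_query_state) (ts : 'I_n.+2 -> tape void) :
    config two_query := (q, ts).

(** A potential that no step raises and every query lowers, whatever the oracle. *)
Definition queries_left (q : two_query_state) : nat :=
  match q with
  | inl (inl _) | inr None => 2
  | inl (inr _) | inr (Some None) => 1
  | inr (Some (Some _)) => 0
  end.

Lemma queries_left_step O (c : config two_query) :
  size (seq_of_opt (query_of c)) + queries_left (step O c).1 <= queries_left c.1.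
Proof.
case: c => [[[q|u]|[[v|]|]] ts] //; rewrite /step /query_of //=.
- by case: (fdelta _ _) => [[q'|] a].
- by case: (fdelta _ _) => [[q'|] a].
- by case: ifP.
- by case: ifP.
Qed.

Lemma size_two_query O x t : size (queries two_query O x t) <= 2.
Proof.
suff: size (queries two_query O x t) + queries_left (run two_query O x t).1 <= 2 by lia.
elim: t => [//|t IHt]; rewrite queries_rcons size_cat /run iterS -!/(run _ _ _ t).
by have := queries_left_step O (run two_query O x t); lia.
Qed.

Lemma iter_step_first O q ts k ts' :
  @exits n F q ts k ts' ->
  iter k (step O) (at_state (inl (inl q)) ts) = at_state (inr None) ts'.
Proof.
elim=> [q0 s a eq_d|q0 s a q' t s' eq_d _ IH].
  by rewrite /= /step /= -/(view_of s) eq_d.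
by rewrite iterSr -IH /step /= -/(view_of s) eq_d.
Qed.

Lemma iter_step_second O b q ts k ts' :
  @exits n (G b) q ts k ts' ->
  iter k (step O) (at_state (inl (inr (Tagged (fun b => fstate (G b)) q))) ts) =
  at_state (inr (Some None)) ts'.
Proof.
elim=> [q0 s a eq_d|q0 s a q' t s' eq_d _ IH].
  by rewrite /= /step /= -/(view_of s) eq_d.
by rewrite iterSr -IH /step /= -/(view_of s) eq_d.
Qed.

(** The 2 extra steps are the queries; [rev] is there because a store lists the query tape with the
    last bit first. *)
Lemma two_query_verdict O x st0 t1 st1 t2 st2 :
  nth [::] st0 0 = x -> (forall j, 0 < j -> nth [::] st0 j = [::]) ->
  computes F st0 t1 st1 ->
  computes (G (tnth O ord0 (rev (nth [::] st1 1)))) st1 t2 st2 ->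
  verdict (run two_query O x (t1 + t2 + 2)) = Some (tnth O ord0 (rev (nth [::] st2 1))).
Proof.
move=> st0x st0_nil hF hG.
pose ts0 : 'I_n.+2 -> tape void := (init two_query x).2.
have st_ts0 : stored st0 ts0.
  move=> j; rewrite /ts0 /=; case: (eqVneq j ord0) => [->|j0]; first by rewrite st0x.
  rewrite st0_nil ?lt0n //; have /negbTE j0' : val j != 0 by [].
  rewrite /holds j0'; split=> // i; rewrite cats0 nth_nil.
  by case: (_ != 1) i => [[|[|i]]|i]; rewrite /= ?nth_nil.
have [k1 [ts1 [le_k1 exF st_ts1]]] := hF _ st_ts0.
have [k2 [ts2 [le_k2 exG st_ts2]]] := hG _ st_ts1.
have run1 : run two_query O x k1 = at_state (inr None) ts1 by apply: iter_step_first exF.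
have run2 : run two_query O x (k2 + k1.+1) = at_state (inr (Some None)) ts2.
  rewrite /run iterD iterS -/(run _ _ _ k1) run1 -(iter_step_second O exG).
  congr iter; rewrite /step /= /query_word (bits_of_holds (st_ts1 (Ordinal (isT : 1 < n.+2)))) /=.
  by case: (tnth _ _ _).
have run3 : run two_query O x (k2 + k1.+1).+1 =
    at_state (inr (Some (Some (tnth O ord0 (rev (nth [::] st2 1)))))) ts2.
  rewrite /run iterS -/(run _ _ _ _) run2 /step /= /query_word.
  by rewrite (bits_of_holds (st_ts2 (Ordinal (isT : 1 < n.+2)))) /=; case: ifP.
rewrite (@verdict_stable _ _ O x (k2 + k1.+1).+1) ?run3 //; lia.
Qed.

End TwoQuery.

(** * Exponential padding and the reductions *)

(* [tX] and [tY] hold the input, [tU] and [tV] unary numbers; [tC] is a binary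
   counter as wide as the word on [tQ] is long, [tP] holds its value in unary, and
   [tZ] keeps the bits set to 0 while a carry propagates. *)
Notation tape_no k := (@Ordinal 9 k isT).
Notation tI := (tape_no 0).
Notation tQ := (tape_no 1).
Notation tX := (tape_no 2).
Notation tY := (tape_no 3).
Notation tU := (tape_no 4).
Notation tV := (tape_no 5).
Notation tP := (tape_no 6).
Notation tC := (tape_no 7).
Notation tZ := (tape_no 8).

Notation fragment9 := (fragment 7).
Notation computes9 := (@computes 7).

Definition stacks (i q x y u v p c z : word) : store := [:: i; q; x; y; u; v; p; c; z].

Lemma computes_cat (F G : fragment9) st t st1 t' st2 t'' :
  computes F st t st1 -> computes G st1 t' st2 -> t + t' <= t'' ->
  computes (fseq F G) st t'' st2.
Proof. by move=> hF hG le; apply: computes_le le (computes_seq hF hG). Qed.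

Lemma computes_eq (F : fragment9) st t st1 st2 :
  computes F st t st1 -> st1 = st2 -> computes F st t st2.
Proof. by move=> + <-. Qed.

Lemma catrev_rcons T (s : seq T) a t : catrev (rcons s a) t = a :: catrev s t.
Proof. by rewrite -cats1 catrev_catl. Qed.

Lemma catrev_nil T (s : seq T) : catrev s [::] = rev s.
Proof. by []. Qed.

Lemma catrev_nseq T (a : T) m k : catrev (nseq m a) (nseq k a) = nseq (m + k) a.
Proof. by rewrite catrevE rev_nseq nseqD. Qed.

Lemma computes_push9 (j : 'I_9) b (st : store) : j != 0 :> nat ->
  computes9 (push j b) st 2 (set_nth [::] st j (b :: nth [::] st j)).
Proof. exact: computes_push. Qed.

Fixpoint write_word (w : word) (F : fragment9) : fragment9 :=
  if w is b :: w' then fseq (push tQ b) (write_word w' F) else F.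

Lemma computes_write_word w F i q x y u v p c z t st :
  computes9 F (stacks i (catrev w q) x y u v p c z) t st ->
  computes9 (write_word w F) (stacks i q x y u v p c z) (size w * 2 + t) st.
Proof.
elim: w q => [|b w IHw] q hF //.
apply: computes_cat (IHw _ hF) _ => /=; first exact: (@computes_push 7 tQ b (stacks _ _ _ _ _ _ _ _ _)).
by lia.
Qed.


(** * Writing the exponentially padded input *)

Definition power2 : fragment9 :=
  foreach tX (fun b => fseq (push tY b)
    (fseq (foreach tU (fun=> fseq (push tV true) (push tV true)))
          (foreach tV (push tU)))).

(** Each symbol popped from [tX] is saved on [tY] and doubles the unary number on [tU]. *)
Lemma computes_power2 i q x y p c z :
  computes9 power2 (stacks i q x y [:: true] [::] p c z)
    (size x * (17 * 2 ^ size x + 7) + 1)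
    (stacks i q [::] (catrev x y) (nseq (2 ^ size x) true) [::] p c z).
Proof.
rewrite -[7]/(4 + 3) addnA.
apply: (@computes_foreach 7 tX _
  (fun l1 l2 => stacks i q l2 (catrev l1 y) (nseq (2 ^ size l1) true) [::] p c z)) => //.
move=> l1 b l2 def_x /=; rewrite catrev_rcons size_rcons.
apply: computes_cat.
- exact: computes_push9.
- apply: computes_cat.
  + apply: (@computes_foreach 7 tU _ (fun l1' l2' =>
      stacks i q l2 (b :: catrev l1 y) l2' (nseq (2 * size l1') true) p c z) 4) => // l1' b' l2' _.
    rewrite size_rcons mulnS.
    by apply: computes_cat; [exact: computes_push9 | exact: computes_push9 | ].
  + apply: computes_eq; first exact: computes_move.
    by rewrite /= catrev_nil rev_nseq size_nseq expnS.
  + exact: leqnn.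
have : 2 ^ size l1 <= 2 ^ size x.
  by rewrite leq_exp2l // def_x size_cat leq_addr.
rewrite /= !size_nseq; lia.
Qed.

Definition write_padded : fragment9 :=
  fseq (foreach tI (push tX)) (fseq (push tU true) (fseq power2
    (fseq (foreach tU (push tQ)) (fseq (push tQ false) (foreach tY (push tQ)))))).

Lemma computes_write_padded x :
  computes9 write_padded (stacks x [::] [::] [::] [::] [::] [::] [::] [::])
    (50 * 2 ^ size x * 2 ^ size x)
    (stacks [::] (catrev x (false :: nseq (2 ^ size x) true)) [::] [::] [::] [::] [::] [::] [::]).
Proof.
apply: computes_cat; [exact: computes_move | | ].
- apply: computes_cat; [exact: computes_push9 | | exact: leqnn].
  apply: computes_cat; [exact: computes_power2 | | exact: leqnn].
  apply: computes_cat; [exact: computes_move | | exact: leqnn].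
  apply: computes_cat; [exact: computes_push9 | | exact: leqnn].
  apply: computes_eq; first exact: computes_move.
  by rewrite /= !catrev_nil revK rev_nseq size_rev.
rewrite /= !(catrev_nil, revK, size_nseq, size_rev).
have : size x < 2 ^ size x by rewrite ltn_expl.
by move: (size x) (2 ^ size x) => n N; nia.
Qed.

(** * Powers of the input length plus two, in unary *)

Definition grow : fragment9 :=
  fseq (foreach tU (fun=> fseq (push tV true) (fseq (push tV true)
         (fseq (foreach tX (fun b => fseq (push tY b) (push tV true)))
               (foreach tY (push tX))))))
       (foreach tV (push tU)).

(** Each mark on [tU] yields two marks on [tV] directly and one more per symbol of [x], which
    travels to [tY] and back. *)
Lemma computes_grow i q x k p c z :
  computes9 grow (stacks i q x [::] (nseq k true) [::] p c z) (20 * (k * (size x + 2)) + 2)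
    (stacks i q x [::] (nseq (k * (size x + 2)) true) [::] p c z).
Proof.
apply: computes_cat.
- apply: (@computes_foreach 7 tU _
    (fun l1 l2 => stacks i q x [::] l2 (nseq (size l1 * (size x + 2)) true) p c z)
    (12 * size x + 6)) => //.
  move=> l1 b l2 _; rewrite size_rcons.
  apply: computes_cat; [exact: computes_push9 | | ].
    apply: computes_cat; [exact: computes_push9 | | exact: leqnn].
    apply: computes_cat; [ | | exact: leqnn].
      apply: (@computes_foreach 7 tX _ (fun l1' l2' =>
        stacks i q l2' (catrev l1' [::]) l2
          (nseq (size l1' + (2 + size l1 * (size x + 2))) true) p c z) 4) => //.
      move=> l1' b' l2' _; rewrite size_rcons catrev_rcons.
      by apply: computes_cat; [exact: computes_push9 | exact: computes_push9 | ].
    apply: computes_eq; first exact: computes_move.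
    by rewrite /= !catrev_nil revK addnA mulSn.
  by rewrite /= catrev_nil size_rev; lia.
- apply: computes_eq; first exact: computes_move.
  by rewrite /= catrev_nil rev_nseq size_nseq.
- by rewrite /= !size_nseq; nia.
Qed.

Fixpoint grow_iter (c : nat) : fragment9 :=
  if c is c'.+1 then fseq grow (grow_iter c') else grow.

Lemma computes_grow_iter d i q x k p c z :
  computes9 (grow_iter d) (stacks i q x [::] (nseq k true) [::] p c z)
    (d.+1 * (20 * (k * (size x + 2) ^ d.+1) + 2))
    (stacks i q x [::] (nseq (k * (size x + 2) ^ d.+1) true) [::] p c z).
Proof.
elim: d k => [|d IHd] k; first by rewrite expn1 mul1n; apply: computes_grow.
apply: computes_cat; [exact: computes_grow | rewrite expnS mulnA; exact: IHd | ].
have : 0 < (size x + 2) ^ d.+1 by rewrite expn_gt0 addn2.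
rewrite [(_ + 2) ^ d.+2]expnS (mulnA k).
move: (k * (size x + 2)) ((size x + 2) ^ d.+1) => a e e_gt0.
have : a <= a * e by rewrite leq_pmulr.
by rewrite [d.+2 * _]mulSn; lia.
Qed.

(** * Stages and the binary counter that finds them *)

Definition stage (k : nat) : nat := iter k (fun N => N + 2 ^ N) 0.

(* Binary numbers, least significant bit first. *)
Fixpoint value (c : word) : nat := if c is b :: c' then b + 2 * value c' else 0.

Lemma value_lt c : value c < 2 ^ size c.
Proof. by elim: c => [//|b c IHc] /=; rewrite expnS; case: b; lia. Qed.

(** The arithmetic of a carry: with [value_zeros], turning [a] ones and a [false] into [a] zeros and
    a [true] adds one. *)
Lemma value_ones a c : (value (nseq a true ++ c)).+1 = 2 ^ a * (value c).+1.
Proof. by elim: a => [|a IHa] /=; rewrite ?mul1n // expnS -mulnA -IHa; lia. Qed.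

Lemma value_zeros a c : value (nseq a false ++ c) = 2 ^ a * value c.
Proof. by elim: a => [|a IHa] /=; rewrite ?mul1n // expnS -mulnA -IHa. Qed.

Lemma leading_ones c :
  (exists a, c = nseq a true) \/ (exists a c', c = nseq a true ++ false :: c').
Proof.
elim: c => [|[|] c IHc]; [by left; exists 0 | | by right; exists 0, c].
by case: IHc => [[a ->] | [a [c' ->]]]; [left; exists a.+1 | right; exists a.+1, c'].
Qed.

(* The width of the counter is the current stage, so the counter overflows exactly
   when the next stage is reached. *)
Definition increment : fragment9 :=
  fseq (fwhile tC (pred1 (bit true)) (fseq (pop tC) (push tZ false)))
    (fseq (fif tC isSome (fseq (pop tC) (push tC true))
             (foreach tP (fun=> fseq (push tC false) (push tQ true))))
          (foreach tZ (push tC))).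

Lemma computes_carry i q x y u v p a c z :
  ohead c != Some true ->
  computes9 (fwhile tC (pred1 (bit true)) (fseq (pop tC) (push tZ false)))
    (stacks i q x y u v p (nseq a true ++ c) z) (4 * a + 1)
    (stacks i q x y u v p c (nseq a false ++ z)).
Proof.
move=> c_head; elim: a z => [|a IHa] z.
  by apply: computes_while_stop => //; case: c c_head => [|[]].
have -> : nseq a.+1 false ++ z = nseq a false ++ false :: z by rewrite -addn1 nseqD -catA.
apply: computes_le (computes_while_loop (t := 3) _ _ _ (IHa _)) => //; first lia.
by apply: computes_cat; [exact: computes_pop | exact: computes_push9 | ].
Qed.

Lemma computes_increment i q x y u v p a c :
  computes9 increment (stacks i q x y u v p (nseq a true ++ false :: c) [::]) (9 * a + 10)
    (stacks i q x y u v p (nseq a false ++ true :: c) [::]).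
Proof.
apply: computes_cat; first exact: computes_carry.
- apply: computes_cat; last exact: leqnn.
    apply: computes_if => //=.
    apply: computes_cat; [exact: computes_pop | exact: computes_push9 | exact: leqnn].
  apply: computes_eq; first exact: computes_move.
  by rewrite /= cats0 catrevE rev_nseq.
- by rewrite /= cats0 size_nseq; lia.
Qed.

(** The carry exhausts the counter; emptying [tP] then lengthens both counter and selector by
    [size p]. If this is [2 ^ a], they pass from one stage to the next. *)
Lemma computes_overflow i q x y u v p a :
  computes9 increment (stacks i q x y u v p (nseq a true) [::]) (9 * a + 7 * size p + 10)
    (stacks i (nseq (size p) true ++ q) x y u v [::] (nseq (a + size p) false) [::]).
Proof.
rewrite -[nseq a true]cats0.
apply: computes_cat; first exact: computes_carry.
- apply: computes_cat; last exact: leqnn.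
    apply: computes_if => //=.
    apply: (@computes_foreach 7 tP _ (fun l1 l2 =>
      stacks i (nseq (size l1) true ++ q) x y u v l2 (nseq (size l1) false) (nseq a false ++ [::])) 4) => //.
    move=> l1 b l2 _; rewrite size_rcons.
    by apply: computes_cat; [exact: computes_push9 | exact: computes_push9 | ].
  apply: computes_eq; first exact: computes_move.
  by rewrite /= cats0 catrev_nseq.
- by rewrite /= cats0 size_nseq; lia.
Qed.

Definition select : fragment9 := foreach tU (fun=> fseq (push tP true) increment).

Lemma computes_select i x y u v :
  exists k p c, [/\ stage k + p = size u, p < 2 ^ stage k &
    computes9 select (stacks i [::] x y u v [::] [::] [::]) (size u * (20 * size u + 30) + 1)
      (stacks i (nseq (stage k) true) x y [::] v (nseq p true) c [::])].
Proof.
(* The counter is as wide as the current stage, and its value [p] is the number of marks read beyond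
   that stage. *)
pose inv (l1 l2 : word) (st : store) := exists k c, let p := value c in
  [/\ st = stacks i (nseq (stage k) true) x y l2 v (nseq p true) c [::],
      size c = stage k & stage k + p = size l1].
have [| | |st' comp [k [c [def_st' sz_c sz_u]]]] :=
    @computes_foreach_inv 7 tU (fun=> fseq (push tP true) increment) inv
      (20 * size u + 27) u (stacks i [::] x y u v [::] [::] [::]) isT.
- by move=> l1 l2 st [k [c [-> _ _]]].
- move=> l1 b l2 st def_u [k [c [-> sz_c]]]; set p := value c => sz_l1.
  have le_l1 : size l1 < size u by rewrite def_u size_cat /= addnS ltnS leq_addr.
  case: (leading_ones c) => [[a def_c] | [a [c' def_c]]].
    (* The counter is full: the new mark is number [2 ^ stage k] beyond the stage, so the next stage
       is reached. *)
    have a_k : a = stage k by rewrite -sz_c def_c size_nseq.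
    have val_c : p.+1 = 2 ^ a by rewrite /p def_c -[nseq _ _]cats0 value_ones muln1.
    clearbody p; subst c.
    exists (stacks i (nseq (stage k.+1) true) x y l2 v [::] (nseq (stage k.+1) false) [::]).
      apply: computes_cat; first exact: computes_push9.
      - apply: computes_eq; first exact: (@computes_overflow _ _ _ _ _ _ (true :: nseq p true)).
        by rewrite [size _]/= size_nseq val_c a_k -nseqD addnC.
      - by rewrite /= size_nseq; lia.
    exists k.+1, (nseq (stage k.+1) false).
    rewrite -[nseq _ false]cats0 value_zeros muln0 cats0 size_nseq size_rcons.
    by split=> //; rewrite /= -a_k -val_c a_k; lia.
  have val_c : p.+1 = value (nseq a false ++ true :: c').
    by rewrite /p def_c value_ones value_zeros.
  clearbody p; subst c.
  exists (stacks i (nseq (stage k) true) x y l2 v (nseq p.+1 true) (nseq a false ++ true :: c') [::]).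
    apply: computes_cat; first exact: computes_push9.
    - exact: (@computes_increment _ _ _ _ _ _ (true :: nseq p true)).
    - by rewrite size_cat size_nseq /= in sz_c; lia.
  exists k, (nseq a false ++ true :: c'); rewrite -val_c size_rcons; split=> //; last lia.
  by rewrite -sz_c !size_cat !size_nseq.
- by exists 0, [::].
exists k, (value c), c; split=> //; first by rewrite -sz_c value_lt.
by rewrite -def_st'; apply: computes_le comp; lia.
Qed.

(** * The two-query reduction *)

Definition prepare (d : nat) : fragment9 :=
  fseq (foreach tI (push tX)) (fseq (push tU true) (fseq (grow_iter d) select)).

(** The selector is a prefix of the code word, so the query tape is merely extended: by the marks
    left on [tP], then by [0 b 1^i 0 x]. *)
Definition finish (i : nat) (b : bool) : fragment9 :=
  fseq (foreach tP (push tQ)) (write_word (false :: b :: nseq i true ++ [:: false])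
    (fseq (foreach tX (push tY)) (foreach tY (push tQ)))).

Lemma computes_finish i b m k p x c :
  stage k + p = m ->
  computes9 (finish i b)
    (stacks [::] (nseq (stage k) true) (rev x) [::] [::] [::] (nseq p true) c [::])
    (5 * m + 2 * i + 10 * size x + 9)
    (stacks [::] (rev (nseq m true ++ false :: b :: nseq i true ++ false :: x))
       [::] [::] [::] [::] [::] c [::]).
Proof.
move=> def_m; apply: computes_cat; first exact: computes_move.
  apply: computes_write_word.
  apply: computes_cat; [exact: computes_move | | exact: leqnn].
  apply: computes_eq; first exact: computes_move.
  rewrite /= catrev_nil revK catrev_nseq addnC def_m.
  have -> : false :: b :: nseq i true ++ false :: x =
      (false :: b :: nseq i true ++ [:: false]) ++ x by rewrite /= -catA.
  by rewrite rev_cat rev_nseq -catrevE !catrev_catl /= catrev_catl.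
by rewrite /= !(catrev_nil, revK, size_rev, size_nseq, size_cat) /=; lia.
Qed.

Definition reduction (d i : nat) : oracle_machine 1 := two_query (prepare d) (finish i).

Lemma verdict_reduction d i (O : 1.-tuple language) x
    (m := (size x + 2) ^ d.+1) :
  exists k (b := tnth O ord0 (nseq (stage k) true)), stage k <= m < stage k.+1 /\
    verdict (run (reduction d i) O x ((100 + 22 * d.+1 + 2 * i) * (m * m))) =
      Some (tnth O ord0 (nseq m true ++ false :: b :: nseq i true ++ false :: x)).
Proof.
have [k [p [c [sz_m lt_p comp]]]] := computes_select [::] (rev x) [::] (nseq m true) [::].
rewrite size_nseq in sz_m comp.
have comp1 : computes9 (prepare d) (stacks x [::] [::] [::] [::] [::] [::] [::] [::])
    (size x * 5 + 1 + (2 + (d.+1 * (20 * m + 2) + (m * (20 * m + 30) + 1))))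
    (stacks [::] (nseq (stage k) true) (rev x) [::] [::] [::] (nseq p true) c [::]).
  apply: computes_cat; [exact: computes_move | | exact: leqnn].
  apply: computes_cat; [exact: computes_push9 | | exact: leqnn].
  have grown := @computes_grow_iter d [::] [::] (rev x) 1 [::] [::] [::].
  rewrite !mul1n size_rev -/m in grown.
  by apply: computes_cat; [exact: grown | exact: comp | ].
have comp2 b := @computes_finish i b m k p x c sz_m.
exists k; split; first by rewrite -sz_m leq_addr /= ltn_add2l.
have halted := @two_query_verdict 7 _ (finish i) O x
  (stacks x [::] [::] [::] [::] [::] [::] [::] [::]) _ _ _ _ erefl _ comp1 (comp2 _).
rewrite /= revK rev_nseq in halted.
rewrite -halted; last by case=> [//|[|[|[|[|[|[|[|[|[|j]]]]]]]]]].
apply: verdict_stable; last by rewrite halted //; case=> [//|[|[|[|[|[|[|[|[|[|j]]]]]]]]]].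
(* From this bound, every term of the running time is at most a constant times [m * m]. *)
have : size x + 2 <= m by rewrite /m expnS leq_pmulr // expn_gt0 addn2.
clearbody m => le_x; have le_m : m <= m * m by rewrite leq_pmulr //; lia.
have := leq_mul (leqnn d) le_m; have : i <= i * (m * m) by rewrite leq_pmulr //; lia.
by nia.
Qed.

Lemma leq_expl m n e : m <= n -> m ^ e <= n ^ e.
Proof. by case: e => // e; rewrite leq_exp2r. Qed.

(** For [n <= 1] the additive constant suffices; for larger [n], [K <= n ^ K] and
    [n + 2 <= n ^ 2]. *)
Lemma poly_bound K e : exists c, forall n, K * (n + 2) ^ e <= n ^ c + c.
Proof.
exists (K + 2 * e + K * 3 ^ e) => n.
have [le_n1 | lt_1n] := leqP n 1.
  apply: leq_trans (leq_addl _ _); apply: leq_trans (leq_addl _ _).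
  by rewrite leq_mul2l leq_expl ?orbT //; lia.
apply: leq_trans (leq_addr _ _).
apply: (@leq_trans (n ^ (K + 2 * e))); last by rewrite leq_pexp2l ?leq_addr //; lia.
rewrite expnD leq_mul //.
  by apply: leq_trans (leq_expl _ lt_1n); rewrite ltnW // ltn_expl.
by rewrite expnM leq_expl //; nia.
Qed.

(** * The oracle and the complete set *)

Lemma stage_lt k : stage k < stage k.+1.
Proof. by rewrite /= -addn1 leq_add2l expn_gt0. Qed.

Lemma leq_stage k l : k <= l -> stage k <= stage l.
Proof. by apply: (homo_leq (r := leq)) => [//||i]; [exact: leq_trans | exact: ltnW (stage_lt i)]. Qed.

Lemma stage_ge k : k <= stage k.
Proof. by elim: k => [//|k IHk]; apply: leq_ltn_trans IHk (stage_lt k). Qed.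

Lemma stage_exists m : exists k, m < stage k.+1.
Proof. by exists m; apply: leq_trans (stage_ge _). Qed.

Definition stage_index m := ex_minn (stage_exists m).

Lemma stage_indexP m k : stage k <= m < stage k.+1 -> stage_index m = k.
Proof.
case/andP=> le_km lt_mk; rewrite /stage_index; case: ex_minnP => l lt_ml min_l.
apply/eqP; rewrite eqn_leq min_l //= leqNgt; apply/negP => lt_lk.
by have := leq_stage lt_lk; lia.
Qed.

(** The last stage up to [m], that is the length of the selector for code words with [m] leading
    ones. *)
Definition sel m := stage (stage_index m).

Lemma sel_stage m k : stage k <= m < stage k.+1 -> sel m = stage k.
Proof. by move=> /stage_indexP; rewrite /sel => ->. Qed.

Definition payload (y : word) : word := drop (index false y).+1 y.

(** A word [1^l 0 v] with [l >= 2 ^ size v] stands for [v]. A nonempty word of ones has empty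
    payload and stands for the empty word. *)
Definition padded (A : language) : language :=
  fun y => (2 ^ size (payload y) <= index false y) && A (payload y).

Lemma padded_agree (A A' : language) L y :
  (forall v, 2 ^ size v <= L -> A v = A' v) -> size y <= L -> padded A y = padded A' y.
Proof.
move=> agree le_y; rewrite /padded; case: leqP => //= le; apply: agree.
by apply: leq_trans le (leq_trans (index_size _ _) le_y).
Qed.

Lemma index_ones m w : index false (nseq m true ++ false :: w) = m.
Proof. by elim: m => //= m ->. Qed.

Lemma payload_ones m w : payload (nseq m true ++ false :: w) = w.
Proof. by rewrite /payload index_ones; elim: m => [|m IHm] /=; rewrite ?drop0. Qed.

Lemma no_false v : false \notin v -> v = nseq (size v) true.
Proof. by elim: v => [//|[|] v IHv] //= /IHv <-. Qed.

Definition upd (beta : nat -> bool) N b : nat -> bool :=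
  fun n => if n == N then b else beta n.

(* A word [1^N] has the value [beta N].  The word [1^m 0 b 1^i 0 x] tells
   whether the [i]-th machine accepts [x] within [2 ^ m] steps in the world
   where the bit of [beta] at [sel m] is [b]. *)
Definition language_step (G : (nat -> bool) -> language) (beta : nat -> bool) : language :=
  fun w =>
  if false \notin w then beta (size w) else
  let m := index false w in
  let b := head false (payload w) in
  let ix := behead (payload w) in
  let x := payload ix in
  (size x <= m) &&
  (verdict (run (@machine_of 1 (index false ix))
     [tuple padded (G (upd beta (sel m) b))] x (2 ^ m)) == Some true).

Lemma tnth1 (A : language) i : tnth [tuple A] i = A.
Proof. by rewrite (ord1 i). Qed.

(** Padding makes the recursion well founded: within [2 ^ m] steps no query is long enough to
    concern a word longer than [m], and [m < size w]. *)
Lemma language_step_agree G1 G2 beta1 beta2 w (m := index false w) :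
  (false \notin w -> beta1 (size w) = beta2 (size w)) ->
  (false \in w -> forall b v, size v <= m ->
     G1 (upd beta1 (sel m) b) v = G2 (upd beta2 (sel m) b) v) ->
  language_step G1 beta1 w = language_step G2 beta2 w.
Proof.
rewrite /language_step; case: ifP => [_ -> // | /negbFE w_false _ /(_ w_false) agree].
rewrite -/m; case: leqP => //= le_x.
rewrite (@run_agree _ _ _ [tuple padded (G2 (upd beta2 (sel m) (head false (payload w))))]) // => q.
move=> /query_size le_q; rewrite !tnth1.
(* Here [2 ^ size v <= size x + 2 ^ m < 2 ^ m.+1], as [size x <= m < 2 ^ m]. *)
apply: padded_agree le_q => v le_v; apply: agree; rewrite -ltnS.
rewrite -(@ltn_exp2l 2) //; apply: leq_ltn_trans le_v _.
rewrite expnS mul2n -addnn ltn_add2r; apply: leq_ltn_trans le_x _.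
by rewrite ltn_expl.
Qed.

Definition approx k := iter k language_step (fun _ _ => false).

(** The recursion descends to shorter words, so [(size w).+1] rounds reach the fixed point at
    [w]. *)
Definition lang (beta : nat -> bool) : language := fun w => approx (size w).+1 beta w.

Lemma approx_stable k l beta w :
  size w < k -> size w < l -> approx k beta w = approx l beta w.
Proof.
elim: k l beta w => [//|k IHk] [//|l] beta w lt_k lt_l.
apply: language_step_agree => // w_false b v le_v.
have : index false w < size w by rewrite index_mem.
by move=> lt_w; apply: IHk; lia.
Qed.

Lemma langE beta w : lang beta w = language_step lang beta w.
Proof.
apply: language_step_agree => // w_false b v le_v.
have : index false w < size w by rewrite index_mem.
by move=> lt_w; apply: approx_stable; lia.
Qed.

Lemma lang_ones beta N : lang beta (nseq N true) = beta N.
Proof. by rewrite langE /language_step mem_nseq andbF size_nseq. Qed.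

Lemma lang_local beta beta' w :
  (forall n, n <= size w -> beta n = beta' n) -> lang beta w = lang beta' w.
Proof.
have [n] := ubnP (size w); elim: n w beta beta' => [//|n IHn] w beta beta' lt_w agree.
rewrite !langE; apply: language_step_agree => [_|w_false b v le_v]; first exact: agree.
have lt_m : index false w < size w by rewrite index_mem.
by apply: IHn => [|k le_k]; rewrite /upd; [lia | case: eqP => // _; apply: agree; lia].
Qed.

(** * Diagonalization at the stages *)

(** The machine opposed at a stage is the 2-adic valuation of the index of the stage, so each
    machine is met at arbitrarily late stages. No verdict within [2 ^ N] steps counts as
    rejection. *)
Definition diagonal_bit (beta : nat -> bool) N : bool :=
  (sel N == N) &&
  (verdict (run (@machine_of 2 (logn 2 (stage_index N)))
     [tuple padded (lang beta); lang beta] (nseq N true) (2 ^ N)) != Some true).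

Fixpoint bits_below (N : nat) : nat -> bool :=
  if N is N'.+1 then upd (bits_below N') N' (diagonal_bit (bits_below N') N')
  else fun=> false.

Definition diagonal (N : nat) : bool := diagonal_bit (bits_below N) N.

Lemma bits_belowE N n : bits_below N n = (n < N) && diagonal n.
Proof.
elim: N => [//|N IHN] /=; rewrite /upd ltnS leq_eqVlt.
by case: eqP => [-> //|_]; rewrite IHN.
Qed.

(* On words longer than [N = stage k] and shorter than the next stage, the only
   bit of [diagonal] that matters at all would be the one at [N], and every code
   word there carries its own assumption about it. *)
Lemma lang_own_bit k v (N := stage k) :
  size v < stage k.+1 -> v != nseq N true ->
  lang diagonal v = lang (bits_below N) v.
Proof.
move=> lt_v v_neq.
(* There is no stage strictly between [N] and [stage k.+1], so [diagonal] is false there, as is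
   [bits_below N]. *)
have agree n : n < stage k.+1 -> n != N -> diagonal n = bits_below N n.
  move=> lt_n neq_n; rewrite bits_belowE; case: ltnP => //= le_n.
  rewrite /diagonal /diagonal_bit (@sel_stage n k) ?lt_n ?andbT //.
  by rewrite eq_sym (negbTE neq_n).
rewrite !langE; apply: language_step_agree => [v_true | v_false b w le_w].
  by apply: agree => //; apply: contraNneq v_neq => <-; rewrite -no_false.
have lt_m : index false v < size v by rewrite index_mem.
apply: lang_local => n le_n; rewrite /upd; case: eqP => // neq_n.
(* If the bit at [N] is within reach, then [sel m] is [N] and [upd] has overwritten this bit. *)
apply: agree; first lia; apply/eqP => eq_n; case: neq_n.
by rewrite (@sel_stage _ k) //; lia.
Qed.

(** * Completeness for exponential time *)

Lemma decides_at m (M : oracle_machine m) O D x T :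
  decides M O D -> halts_within M O x T -> verdict (run M O x T) = Some (D x).
Proof.
move=> /(_ x)[t decided] halted; rewrite -decided.
case: (leqP t T) => [le_t | /ltnW le_T]; last by rewrite (verdict_stable le_T halted).
by apply: verdict_stable => //; rewrite decided.
Qed.

Lemma lang_in_EXP beta : EXP (padded (lang beta)) (lang beta).
Proof.
(* As [push tZ true] leaves the query tape alone, the second query repeats the first. *)
pose M := two_query write_padded (fun=> push tZ true).
have verdictM x : verdict (run M [tuple padded (lang beta)] x (50 * 2 ^ size x * 2 ^ size x + 2 + 2)) =
    Some (lang beta x).
  have := @two_query_verdict 7 _ (fun=> push tZ true) [tuple padded (lang beta)] x
    (stacks x [::] [::] [::] [::] [::] [::] [::] [::]) _ _ _ _ erefl _
    (@computes_write_padded x) (@computes_push9 _ _ _ (isT : tZ != 0 :> nat)).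
  rewrite /= catrevE rev_cat revK => -> /=; last by case=> [//|[|[|[|[|[|[|[|[|[|j]]]]]]]]]].
  rewrite tnth1 rev_cons rev_nseq cat_rcons.
  by rewrite /padded payload_ones index_ones leqnn.
exists M; split; last by move=> x; eexists; exact: verdictM.
exists 8 => x; rewrite /halts_within.
rewrite (verdict_stable _ (s := 50 * 2 ^ size x * 2 ^ size x + 2 + 2)) ?verdictM //.
(* The running time is at most [2 ^ (2 * size x + 7)]. *)
have le_n : 2 * size x + 7 <= size x ^ 8 + 8.
  case: (size x) => [|[|n]] //.
  have : n.+2 ^ 2 <= n.+2 ^ 8 by rewrite leq_pexp2l.
  by rewrite expnS expn1; nia.
apply: (@leq_trans (2 ^ (2 * size x + 7))); last by rewrite leq_exp2l.
rewrite mul2n -addnn !expnD.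
have : 0 < 2 ^ size x by rewrite expn_gt0.
by move: (2 ^ size x) => e; nia.
Qed.

Lemma reducible_to_lang beta D :
  EXP (padded (lang beta)) D -> reducible_2T D (lang beta).
Proof.
case=> M [[c timeM] decM]; have [i same_i] := machine_ofP M.
exists (reduction c i); split.
- have [e bound_e] := poly_bound (100 + 22 * c.+1 + 2 * i) (c.+1 + c.+1).
  exists e => O x; have [k [_ halted]] := verdict_reduction c i O x.
  rewrite -expnD in halted.
  by rewrite /halts_within (verdict_stable (bound_e _)) halted.
- move=> x; have [k [stage_m halted]] := verdict_reduction c i [tuple lang beta] x.
  eexists; apply: etrans halted _; rewrite !tnth1 lang_ones; congr Some.
  set m := _ ^ _ in stage_m *; rewrite langE /language_step.
  rewrite mem_cat inE eqxx orbT /= index_ones payload_ones /= payload_ones index_ones.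
  have le_x : size x <= m.
    by apply: (leq_trans (leq_addr 2 _)); rewrite /m expnS leq_pmulr // expn_gt0 addn2.
  (* The exponent [c.+1] in [m] is chosen for this: [2 ^ m] steps cover the whole run of [M]. *)
  have bound : size x ^ c + c <= m.
    have := leq_expl c (leq_addr 2 (size x)); have := leq_expl c (leq_addl (size x) 2).
    by have := @ltn_expl 2 c isT; rewrite /m expnS; nia.
  rewrite le_x same_i (sel_stage stage_m) /=.
  (* The first query returned the true bit, so [upd] changes nothing and the simulated world is the
     actual one. *)
  rewrite (@run_agree _ _ _ [tuple padded (lang beta)]) => [|q _].
    have halted := timeM x; have le_t : 2 ^ (size x ^ c + c) <= 2 ^ m by rewrite leq_exp2l.
    by rewrite (verdict_stable le_t halted) (decides_at decM halted); case: (D x).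
  rewrite !tnth1; apply: (@padded_agree _ _ (size q.2)) => // v _.
  by apply: lang_local => n _; rewrite /upd; case: eqP => [->|].
- by move=> X x t; apply: size_two_query.
Qed.

(** * Failure of autoreducibility *)

(** The sum bounds query lengths on [1^n]. With [q := n %/ d], large [n] satisfy [n < q.+1 ^ 2],
    whence [n ^ c.+2 < q.+1 ^ d <= 2 ^ (q * d) <= 2 ^ n]. *)
Lemma poly_lt_exp c : exists N0, forall n, N0 <= n -> n + (n ^ c + c) < 2 ^ n.
Proof.
pose d := 2 * c.+2; exists (d * d + c + 4) => n le_n.
have lt_n : n ^ c.+2 < 2 ^ n.
  pose q := n %/ d.
  have lt_nd : n < q.+1 * d by rewrite ltn_ceil.
  have lt_nq : n < q.+1 ^ 2.
    apply: leq_trans lt_nd _; rewrite expnS expn1 leq_mul2l /=.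
    by rewrite ltnW // ltnS leq_divRL //; lia.
  apply: (@leq_trans ((q.+1 ^ 2) ^ c.+2)); first by rewrite ltn_exp2r.
  rewrite -expnM -/d; apply: (@leq_trans ((2 ^ q) ^ d)); first by rewrite leq_exp2r // ltn_expl.
  by rewrite -expnM leq_exp2l // leq_divM.
apply: leq_ltn_trans lt_n; rewrite 2!expnS.
have : 0 < n ^ c by rewrite expn_gt0; lia.
move: (n ^ c) => e e_gt0.
have : n <= n * e by rewrite leq_pmulr.
have : e <= n * e by rewrite leq_pmull //; lia.
have : 4 * (n * e) <= n * (n * e) by rewrite leq_mul2r; lia.
by lia.
Qed.

Lemma logn2_large j K : exists2 k, logn 2 k = j & K <= k.
Proof.
exists (2 ^ j * (2 * K).+1); last by have := expn_gt0 2 j; nia.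
by rewrite lognM ?expn_gt0 // pfactorK // lognE /= dvdn2 /= mul2n odd_double /= addn0.
Qed.

Lemma not_autoreducible :
  ~ autoreducible_relative_to (padded (lang diagonal)) (lang diagonal).
Proof.
case=> M [[c timeM] decM no_self]; have [j same_j] := machine_ofP M.
have [N0 large] := poly_lt_exp c; have [k log_k le_k] := logn2_large j N0.
pose N := stage k; pose s := nseq N true; pose T := N ^ c + c.
have {le_k}/large lt_T : N0 <= N := leq_trans le_k (stage_ge k).
have stage_N : stage k <= N < stage k.+1 by rewrite leqnn stage_lt.
pose O := [tuple padded (lang diagonal); lang diagonal].
(* These are the oracles used by [diagonal_bit] to fix the bit at [N]. *)
pose O' := [tuple padded (lang (bits_below N)); lang (bits_below N)].
have same_run : run M O s T = run M O' s T.
  apply: run_agree => -[i v] q_in; have := query_size q_in.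
  rewrite /= size_nseq => le_v.
  case: (unliftP ord_max i) q_in => [i' ->|->] q_in.
    have -> : lift ord_max i' = ord0 by apply: val_inj; rewrite /= (ord1 i').
    (* A query to the first oracle is shorter than [2 ^ N], so it concerns words shorter than [N]
       only. *)
    rewrite /=; apply: (padded_agree _ le_v) => w le_w; apply: lang_local => n le_n.
    rewrite bits_belowE (leq_ltn_trans le_n) // -(@ltn_exp2l 2) //.
    exact: leq_ltn_trans le_w lt_T.
  (* A query to the second oracle is shorter than the next stage [N + 2 ^ N], and is not the input
     [1^N]. *)
  rewrite /=; apply: lang_own_bit.
    apply: leq_ltn_trans le_v _; rewrite /= -/N ltn_add2l.
    exact: leq_ltn_trans (leq_addl _ _) lt_T.
  by apply: contraNneq (no_self (lang diagonal) s T) => eq_v; move: q_in; rewrite eq_v.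
have haltedT (P : 2.-tuple language) : halts_within M P s T.
  by have := timeM P s; rewrite size_nseq.
have := decides_at decM (haltedT _); rewrite -/O same_run lang_ones.
rewrite /diagonal /diagonal_bit (sel_stage stage_N) (stage_indexP stage_N) log_k eqxx /=.
(* The machine halts before the [2 ^ N] steps seen by [diagonal_bit], so its verdict is the one that
   the bit negates. *)
rewrite -/O' -/s same_j (verdict_stable _ (haltedT O')); last lia.
by case: (verdict _) => [[]|].
Qed.

Theorem theorem4p2 :
  exists B A : language,
    complete_2T (EXP B) A /\ ~ autoreducible_relative_to B A.
Proof.
exists (padded (lang diagonal)), (lang diagonal); split; last exact: not_autoreducible.
by split; [exact: lang_in_EXP | exact: reducible_to_lang].
Qed.
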